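(* Suppose that $\varepsilon=0$. Let $k\in\{1,\dots,n\}$ be such that $\Sigma_{\mathrm{pk}}\subseteq\Sigma^{(k)}$. Let $T\ge k+1$ and $u_{[0,T-1]}\in\mathbb{R}^{mT}$. If $$\begin{bmatrix}F & G\end{bmatrix}M_{A,B}^{(k)}D_A^{(k)}\mathcal{H}_{k+1}(u_{[0,T-1]})\neq 0$$ for all nonzero $(F,G)\in\Sigma_{\mathrm{pk}}-\Sigma_{\mathrm{pk}}$ and all $(A,B)\in\Sigma_{\mathrm{pk}}$, then the input $u_{[0,T-1]}$ is $\Sigma_{\mathrm{pk}}$-universal for identification.
   Context: Let $n,m\in\mathbb{N}$, $\varepsilon\ge 0$, and $\Sigma=\mathbb{R}^{n\times n}\times\mathbb{R}^{n\times m}$. A signal $u(0),\dots,u(T-1)\in\mathbb{R}^m$ is identified with the stacked vector $u_{[0,T-1]}\in\mathbb{R}^{mT}$; similarly for $x_{[0,T]}$. For $T\in\mathbb{N}$ and $(A,B)\in\Sigma$, $\mathfrak{B}_T(A,B)$ is the set of all pairs $(u_{[0,T-1]},x_{[0,T]})$, with $u(t)\in\mathbb{R}^m$, $x(t)\in\mathbb{R}^n$, for which there exist $w(0),\dots,w(T-1)\in\mathbb{R}^n$ with $\|w(t)\|\le\varepsilon$ (Euclidean norm) and $x(t+1)=Ax(t)+Bu(t)+w(t)$ for $t=0,\dots,T-1$. $\mathfrak{B}(A,B,u_{[0,T-1]})$ is the set of those elements of $\mathfrak{B}_T(A,B)$ whose input part equals the given $u_{[0,T-1]}$ (the initial state is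 free). For a dataset $\mathcal{D}$, $\Sigma_{\mathcal{D}}=\{(A,B)\in\Sigma\mid \mathcal{D}\in\mathfrak{B}_T(A,B)\}$. $\Sigma_{\mathrm{pk}}\subseteq\Sigma$ is an arbitrary prior knowledge set (it contains the unknown true system, hence is nonempty), and $\Sigma_{\mathrm{pk}}-\Sigma_{\mathrm{pk}}$ is the set of all differences of two of its elements. A dataset $\mathcal{D}\in\mathfrak{B}_T(A,B)$ with $(A,B)\in\Sigma_{\mathrm{pk}}$ is $\Sigma_{\mathrm{pk}}$-informative for identification if $\Sigma_{\mathcal{D}}\cap\Sigma_{\mathrm{pk}}$ is a singleton. An input $u_{[0,T-1]}$ is $\Sigma_{\mathrm{pk}}$-universal for identification if every $\mathcal{D}\in\bigcup_{(A,B)\in\Sigma_{\mathrm{pk}}}\mathfrak{B}(A,B,u_{[0,T-1]})$ is $\Sigma_{\mathrm{pk}}$-informative for identification. For $1\le k\le T$, the Hankel matrix $\mathcal{H}_k(u_{[0,T-1]})$ of depth $k$ is the $mk\times(T-k+1)$ matrix whose $j$-th column ($j=0,\dots,T-k$) is the stacked vector of $u(j),\dots,u(j+k-1)$. $\Sigma^{(k)}$ is the set of $(A,B)\in\Sigma$ such that the minimal polynomial $\mu_A$ of $A$ has degree at most $k$. For $(A,B)\in\Sigma^{(k)}$, $$M_{A,B}^{(k)}=\begin{bmatrix}0 & B & AB & \cdots & A^{k-1}B\\ I_m & 0 & 0 & \cdots & 0\end{bmatrix},\qquad D_A^{(k)}=\begin{bmatrix} d_0 & \cdots & d_{k-1}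 & d_k\\ d_1 & \cdots & d_k & 0\\ \vdots & & \vdots & \vdots\\ d_k & \cdots & 0 & 0\end{bmatrix}\otimes I_m,$$ where $d_0,\dots,d_k\in\mathbb{R}$ satisfy $\sum_{i=0}^k d_iA^i=0$ and $d_k=1$ (if these are not unique, one such choice is fixed for each $A$; for $k=n$ the coefficients of the characteristic polynomial of $A$). The $(i,j)$ entry, $i,j=0,\dots,k$, of the left Kronecker factor is $d_{i+j}$ if $i+j\le k$ and $0$ otherwise. *)

(* Defs.v *)
From mathcomp Require Import all_boot all_order all_algebra.
From mathcomp Require Import boolp classical_sets reals.
From mathcomp Require Import mxtens.

Set Implicit Arguments.
Unset Strict Implicit.
Unset Printing Implicit Defensive.

Import Order.TTheory GRing.Theory Num.Theory.
Local Open Scope ring_scope.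
Local Open Scope classical_set_scope.

(* A signal v(0), ..., v(T-1) is a T-tuple of column vectors, and v`_t is v(t)
   (with junk value 0 for t >= T). *)

Definition system (R : realType) (n m : nat) : Type :=
  ('M[R]_n * 'M[R]_(n, m))%type.

Definition dataset (R : realType) (n m T : nat) : Type :=
  (T.-tuple 'cV[R]_m * T.+1.-tuple 'cV[R]_n)%type.

Definition enorm (R : realType) (n : nat) (w : 'cV[R]_n) : R :=
  Num.sqrt (\sum_(i < n) w i 0 ^+ 2).

Definition behavior (R : realType) (n m T : nat) (eps : R)
    (S : system R n m) : set (dataset R n m T) :=
  [set D : dataset R n m T | exists w : T.-tuple 'cV[R]_n, forall t : nat, (t < T)%N ->
     enorm w`_t <= eps /\
     (D.2)`_t.+1 = S.1 *m (D.2)`_t + S.2 *m (D.1)`_t + w`_t].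

Definition behavior_input (R : realType) (n m T : nat) (eps : R)
    (S : system R n m) (u : T.-tuple 'cV[R]_m) : set (dataset R n m T) :=
  [set D | behavior eps S D /\ D.1 = u].

Definition consistent_systems (R : realType) (n m T : nat) (eps : R)
    (D : dataset R n m T) : set (system R n m) :=
  [set S | behavior eps S D].

Definition informative (R : realType) (n m T : nat) (eps : R)
    (Spk : set (system R n m)) (D : dataset R n m T) : Prop :=
  exists S : system R n m, consistent_systems eps D `&` Spk = [set S].

Definition universal (R : realType) (n m T : nat) (eps : R)
    (Spk : set (system R n m)) (u : T.-tuple 'cV[R]_m) : Prop :=
  forall D : dataset R n m T,
    (\bigcup_(S in Spk) behavior_input eps S u) D -> informative eps Spk D.

Definition set_diff (R : realType) (n m : nat) (Spk : set (system R n m)) :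
    set (system R n m) :=
  [set S - S' | S in Spk & S' in Spk].

(* Block indices: entry c of a stack of k blocks of size m is entry p of block
   i, where (i, p) = mxtens_unindex c, i.e. c = i * m + p; this is the index
   convention of the Kronecker product *t. *)

Definition hankel (R : realType) (m T k : nat) (u : T.-tuple 'cV[R]_m) :
    'M[R]_(k * m, (T - k).+1) :=
  \matrix_(c, j) let ip := mxtens_unindex c in u`_(j + ip.1) ip.2 0.

Definition Sigma_deg (R : realType) (n m k : nat) : set (system R n.+1 m) :=
  [set S | (degree_mxminpoly S.1 <= k)%N].

Definition reach_mx (R : realType) (n m k : nat) (S : system R n m) :
    'M[R]_(n, k * m) :=
  \matrix_(i, c) let jp := mxtens_unindex c in (S.1 ^+ jp.1 *m S.2) i jp.2.

(* The width k.+1 * m is m + k * m by computation. *)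
Definition M_mx (R : realType) (n m k : nat) (S : system R n m) :
    'M[R]_(n + m, k.+1 * m) :=
  block_mx 0 (reach_mx k S) 1%:M 0.

Definition D_mx (R : realType) (m k : nat) (d : nat -> R) :
    'M[R]_(k.+1 * m, k.+1 * m) :=
  (\matrix_(i < k.+1, j < k.+1) if (i + j <= k)%N then d (i + j)%N else 0)
    *t (1%:M : 'M[R]_m).

(* d A 0, ..., d A k are the coefficients of a monic polynomial of degree k
   annihilating A. *)
Definition annihilating_choice (R : realType) (n k : nat)
    (d : 'M[R]_n.+1 -> nat -> R) : Prop :=
  forall A : 'M[R]_n.+1, (degree_mxminpoly A <= k)%N ->
    \sum_(0 <= i < k.+1) d A i *: A ^+ i = 0 /\ d A k = 1.

(* Main.v *)
Require Import Defs.
From mathcomp Require Import all_boot all_order all_algebra.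
From mathcomp Require Import boolp classical_sets reals.
From mathcomp Require Import mxtens.

(** Two systems of the prior knowledge set that explain the same noise-free data
    (u, x) differ by a pair (F, G) with F x(t) + G u(t) = 0 for all t < T.  This
    relation involves the unmeasured initial state, so the state has to be
    eliminated before the hypothesis on the input can be used.  Weighting k + 1
    consecutive instances with an annihilating polynomial d of A does this:
    the free response sums to d(A) x(j) = 0, so the d-weighted sum of
    x(j), ..., x(j+k) is a combination of the inputs u(j), ..., u(j+k) alone,
    and the sum of the weighted relations is column j of [F G] M D H, where H is
    the Hankel matrix of u.  That product therefore vanishes
    ([annihilator_hankel]), and the hypothesis forces (F, G) = 0.

    The elimination is Horner's scheme.  Let s_q be the sum of the
    d_(q+l) x(l) over the l with q + l <= k, and h_q the same sum for the
    inputs; the dynamics give s_q = d_q x(0) + A s_(q+1) + B h_(q+1)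
    ([hsum_step]).  Unrolling from s_0 down to s_(k+1) = 0 leaves d(A) x(0) = 0
    plus the sum of the A^q B h_(q+1) ([hsum_annihilated]).  The h_q are the
    blocks of D applied to the stacked inputs ([D_mx_stack]), and M combines
    them with exactly these weights ([M_mx_stack]). *)

Set Implicit Arguments.
Unset Strict Implicit.
Unset Printing Implicit Defensive.

Import Order.TTheory GRing.Theory Num.Theory.
Local Open Scope ring_scope.
Local Open Scope classical_set_scope.

Definition stack (R : realType) (m k : nat) (v : nat -> 'cV[R]_m) :
    'cV[R]_(k * m) :=
  \col_c v (mxtens_unindex c).1 (mxtens_unindex c).2 0.

(** For q = 0 this is the d-weighted sum of v(0), ..., v(k), and for larger q an
    intermediate value of Horner's scheme for it.  The sum has k + 1 terms for
    every q, with the out-of-range coefficients cut off, so that it is literally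
    block q of D applied to the stack of v. *)
Definition hsum (R : realType) (m k : nat) (d : nat -> R)
    (v : nat -> 'cV[R]_m) (q : nat) : 'cV[R]_m :=
  \sum_(l < k.+1) (if (q + l <= k)%N then d (q + l)%N else 0) *: v l.

Lemma hsum0 (R : realType) (m k : nat) (d : nat -> R) (v : nat -> 'cV[R]_m) :
  hsum k d v 0 = \sum_(l < k.+1) d l *: v l.
Proof. by apply: eq_bigr => l _; rewrite add0n -ltnS ltn_ord. Qed.

Lemma hsum_gt (R : realType) (m k : nat) (d : nat -> R) (v : nat -> 'cV[R]_m)
    (q : nat) : (k < q)%N -> hsum k d v q = 0.
Proof.
move=> ltkq; apply: big1 => l _.
by rewrite leqNgt (leq_trans ltkq (leq_addr _ _)) scale0r.
Qed.

(** Separate the term l = 0 and replace every other x(l) by its predecessor: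
    this advances the coefficient index by one and brings out A and B. *)
Lemma hsum_step (R : realType) (n m k : nat) (d : nat -> R)
    (A : 'M[R]_n) (B : 'M[R]_(n, m))
    (x : nat -> 'cV[R]_n) (v : nat -> 'cV[R]_m) (q : nat) :
  (forall t, (t < k)%N -> x t.+1 = A *m x t + B *m v t) -> (q <= k)%N ->
  hsum k d x q =
    d q *: x 0%N + A *m hsum k d x q.+1 + B *m hsum k d v q.+1.
Proof.
move=> dyn leqk; rewrite /hsum big_ord_recl /= addn0 leqk -addrA; congr (_ + _).
(* The last term of both sums on the right is cut off, which leaves the range
   of l on which the dynamics apply. *)
rewrite 2![in RHS]big_ord_recr /= addSn ltnNge leq_addl /= !scale0r !addr0.
rewrite !mulmx_sumr -big_split /=; apply: eq_bigr => l _.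
by rewrite /bump /= add1n addnS addSn dyn // scalerDr !scalemxAr.
Qed.

(** Eliminates the state: unrolling Horner's scheme collects the initial state
    into d(A) x(0), which vanishes, and leaves a combination of inputs only. *)
Lemma hsum_annihilated (R : realType) (n m k : nat) (d : nat -> R)
    (A : 'M[R]_n) (B : 'M[R]_(n, m))
    (x : nat -> 'cV[R]_n) (v : nat -> 'cV[R]_m) :
  \sum_(i < k.+1) d i *: A ^+ i = 0 ->
  (forall t, (t < k)%N -> x t.+1 = A *m x t + B *m v t) ->
  hsum k d x 0 = \sum_(q < k) A ^+ q *m B *m hsum k d v q.+1.
Proof.
move=> dA0 dyn.
have unroll p : (p <= k.+1)%N -> hsum k d x 0 =
    (\sum_(q < p) d q *: A ^+ q) *m x 0%N
    + \sum_(q < p) A ^+ q *m B *m hsum k d v q.+1 + A ^+ p *m hsum k d x p.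
  elim: p => [_|p IH ltpk].
    by rewrite !big_ord0 mul0mx !add0r expr0 mul1mx.
  rewrite (IH (ltnW ltpk)) (hsum_step d dyn ltpk) !big_ord_recr /=.
  rewrite exprSr mulmxDl !mulmxDr !mulmxA -scalemxAl -scalemxAr.
  by rewrite [X in _ + X = _]addrAC addrA addrACA.
rewrite (unroll k.+1 (leqnn _)) dA0 mul0mx add0r big_ord_recr /=.
by rewrite !hsum_gt // !mulmx0 !addr0.
Qed.

(** The first block is the one that M multiplies by G alone; the remaining ones
    are those that it weights with the A^q B. *)
Lemma stackS (R : realType) (m k : nat) (v : nat -> 'cV[R]_m) :
  stack k.+1 v = col_mx (v 0%N) (stack k (fun q => v q.+1)).
Proof.
apply/matrixP => c z; rewrite !mxE ord1; case: splitP => [i|i] eqc.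
  have -> : v (mxtens_unindex c).1 = v 0%N.
    by rewrite /= eqc divn_small.
  by congr (v 0%N _ _); apply: val_inj; rewrite /= eqc modn_small.
have m_gt0 : (0 < m)%N.
  exact: leq_ltn_trans (leq0n _) (ltn_ord (mxtens_unindex i).2).
rewrite mxE.
have -> : v (mxtens_unindex c).1 = v (mxtens_unindex i).1.+1.
  by rewrite /= eqc divnDl ?dvdnn // divnn m_gt0.
by congr (v _ _ _); apply: val_inj; rewrite /= eqc modnDl.
Qed.

Lemma sum_mxtens (R : realType) (k m : nat) (F : 'I_k -> 'I_m -> R) :
  \sum_(c < k * m) F (mxtens_unindex c).1 (mxtens_unindex c).2 =
  \sum_(i < k) \sum_(j < m) F i j.
Proof.
rewrite pair_big; symmetry; rewrite (reindex (@mxtens_unindex k m)) //=.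
by exists (@mxtens_index k m) => i _; rewrite (mxtens_indexK, mxtens_unindexK).
Qed.

Lemma col_hankel (R : realType) (m T k : nat) (u : T.-tuple 'cV[R]_m)
    (j : 'I_(T - k).+1) :
  col j (hankel k u) = stack k (fun i => u`_(j + i)).
Proof. by apply/matrixP => c z; rewrite !mxE. Qed.

Lemma D_mx_stack (R : realType) (m k : nat) (d : nat -> R)
    (v : nat -> 'cV[R]_m) :
  D_mx m k d *m stack k.+1 v = stack k.+1 (hsum k d v).
Proof.
apply/matrixP => c z; rewrite !mxE summxE.
pose q := (mxtens_unindex c).1; pose p := (mxtens_unindex c).2.
pose e (l : nat) : R := if (q + l <= k)%N then d (q + l)%N else 0.
transitivity (\sum_(l < k.+1) \sum_(r < m) e l * (p == r)%:R * v l r 0).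
  rewrite -(sum_mxtens (fun (l : 'I_k.+1) r => e l * (p == r)%:R * v l r 0)).
  by apply: eq_bigr => b _; rewrite !mxE.
apply: eq_bigr => l _; rewrite (bigD1 p) //= eqxx mulr1 big1 ?addr0 ?mxE //.
by move=> r /negPf; rewrite eq_sym => ->; rewrite mulr0 mul0r.
Qed.

Lemma reach_mx_stack (R : realType) (n m k : nat) (S : system R n m)
    (h : nat -> 'cV[R]_m) :
  reach_mx k S *m stack k h = \sum_(q < k) S.1 ^+ q *m S.2 *m h q.
Proof.
apply/matrixP => i z; rewrite !mxE summxE ord1.
transitivity (\sum_(q < k) \sum_(r < m) (S.1 ^+ q *m S.2) i r * h q r 0).
  rewrite -(sum_mxtens (fun (q : 'I_k) r => (S.1 ^+ q *m S.2) i r * h q r 0)).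
  by apply: eq_bigr => b _; rewrite [reach_mx _ _ _ _]mxE [stack _ _ _ _]mxE.
by apply: eq_bigr => q _; rewrite [RHS]mxE.
Qed.

Lemma M_mx_stack (R : realType) (n m k : nat) (S : system R n m)
    (h : nat -> 'cV[R]_m) :
  M_mx k S *m stack k.+1 h =
  col_mx (\sum_(q < k) S.1 ^+ q *m S.2 *m h q.+1) (h 0%N).
Proof.
rewrite stackS; apply: etrans (mul_block_col _ _ _ _ _ _) _.
by rewrite !mul0mx add0r addr0 mul1mx reach_mx_stack.
Qed.

Lemma enorm_le0 (R : realType) (n : nat) (w : 'cV[R]_n) :
  enorm w <= 0 -> w = 0.
Proof.
rewrite /enorm => wle0; apply/matrixP => i j; rewrite ord1 mxE.
have sq_ge0 (l : 'I_n) : true -> 0 <= w l 0 ^+ 2 by rewrite sqr_ge0.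
have /eqP : \sum_(l < n) w l 0 ^+ 2 = 0.
  apply/le_anti/andP; split; last exact: sumr_ge0.
  by rewrite -sqrtr_eq0 eq_le wle0 sqrtr_ge0.
rewrite psumr_eq0 // => /allP /(_ i (mem_index_enum _)).
by rewrite sqrf_eq0 => /eqP.
Qed.

Lemma behavior_noise_free (R : realType) (n m T : nat) (S : system R n m)
    (D : dataset R n m T) (t : nat) :
  behavior 0 S D -> (t < T)%N ->
  (D.2)`_t.+1 = S.1 *m (D.2)`_t + S.2 *m (D.1)`_t.
Proof.
by case=> w Hw /Hw[/enorm_le0 w0 ->]; rewrite w0 addr0.
Qed.

(** Column j of the product is the d-weighted sum of the relations at times
    j, ..., j + k.  The last column has j = T - k - 1, so the relations are used
    exactly up to t = T - 1, where the data end. *)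
Lemma annihilator_hankel (R : realType) (n m T k : nat) (d : nat -> R)
    (S FG : system R n m) (D : dataset R n m T) :
  \sum_(i < k.+1) d i *: S.1 ^+ i = 0 -> (k < T)%N -> behavior 0 S D ->
  (forall t, (t < T)%N -> FG.1 *m (D.2)`_t + FG.2 *m (D.1)`_t = 0) ->
  row_mx FG.1 FG.2 *m M_mx k S *m D_mx m k d *m hankel k.+1 D.1 = 0.
Proof.
move=> dA0 ltkT bD ann; apply/trmx_inj/row_matrixP => j.
rewrite -!tr_col col0; congr (_^T).
rewrite colE -mulmxA -colE col_hankel.
rewrite -!mulmxA D_mx_stack M_mx_stack mul_row_col.
have ltjT (i : nat) : (i <= k)%N -> (j + i < T)%N.
  rewrite -ltnS -addnS => leik.
  by apply: leq_trans (leq_add (leq_ord j) leik) _; rewrite subnK.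
rewrite -(hsum_annihilated (x := fun i => (D.2)`_(j + i)) dA0); last first.
  move=> t ltk; rewrite addnS.
  by apply: behavior_noise_free bD _; apply: ltjT (ltnW ltk).
rewrite !hsum0 !mulmx_sumr -big_split big1 //= => i _.
by rewrite -!scalemxAr -scalerDr ann ?scaler0 // ltjT // -ltnS.
Qed.

Theorem theorem14 (R : realType) (n m : nat) (eps : R) (heps : eps = 0)
    (Spk : set (system R n.+1 m)) (hne : Spk !=set0)
    (k : nat) (hk : (1 <= k <= n.+1)%N)
    (hSpk : Spk `<=` @Sigma_deg R n m k)
    (d : 'M[R]_n.+1 -> nat -> R) (hd : annihilating_choice k d)
    (T : nat) (hT : (k.+1 <= T)%N) (u : T.-tuple 'cV[R]_m)
    (hu : forall FG S : system R n.+1 m,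
        set_diff Spk FG -> FG != 0 -> Spk S ->
        row_mx FG.1 FG.2 *m M_mx k S *m D_mx m k (d S.1) *m hankel k.+1 u != 0) :
  universal eps Spk u.
Proof.
subst eps => D [S SpkS [bD Du]]; subst u.
exists S; apply/seteqP; split => [S' [bD' SpkS']|_ ->]; last by split.
apply/eqP; rewrite -subr_eq0.
apply: contraT => neq; have := hu (S' - S) S _ neq SpkS.
have [dA0 _] := hd _ (hSpk _ SpkS); rewrite big_mkord in dA0.
rewrite (annihilator_hankel dA0 hT bD) ?eqxx => [/(_ _)/negP[]//|t ltt].
  by exists S' => //; exists S.
have := behavior_noise_free bD' ltt; rewrite (behavior_noise_free bD ltt).
by move=> E; rewrite !mulmxBl addrACA -opprD -E subrr.
Qed.
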